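(* Let $B=B(y)$ be an arbitrary smooth function of one variable on an interval, and fix antiderivatives $\int B(y)\,dy$ and $\int e^{-2\int B(y)dy}\,dy$. Define functions of $(y,p,Z)$, $Z\neq0$, by $$X=-\frac{8e^{-2\int B(y)dy}Z^3p}{(Z^2p^2+4)^2},\qquad Y=\int e^{-2\int B(y)dy}\,dy+\frac{e^{-2\int B(y)dy}\left(-2Z^4p^2+8Z^2\right)}{(Z^2p^2+4)^2},$$ $$U=\ln\left(\frac{(Z^2p^2+4)^3}{64Z^2}\right)+4\int B(y)\,dy .$$ Then, wherever $(X,Y,Z)$ can be used as local coordinates in place of $(y,p,Z)$, the function $U=U(X,Y,Z)$ implicitly defined by these relations is a solution of the $SU(\infty)$-Toda equation $$U_{XX}+U_{YY}=(e^U)_{ZZ}.$$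
   Context: Subscripts denote partial derivatives with respect to the independent variables $(X,Y,Z)$. *)

(* Defs.v *)
(* Stdlib's real numbers with Coquelicot. *)
From Stdlib Require Import Reals.
From Coquelicot Require Import Coquelicot.
Open Scope R_scope.

(* A notation, so that Coquelicot's product uniform structure (hence [open]
   and [continuous]) is inferred on it. *)
Notation R3 := (R * R * R)%type.

Inductive axis : Set := axis1 | axis2 | axis3.

Definition coord (i : axis) (w : R3) : R :=
  match i with
  | axis1 => fst (fst w)
  | axis2 => snd (fst w)
  | axis3 => snd w
  end.

Definition set_coord (i : axis) (w : R3) (t : R) : R3 :=
  match i with
  | axis1 => (t, coord axis2 w, coord axis3 w)
  | axis2 => (coord axis1 w, t, coord axis3 w)
  | axis3 => (coord axis1 w, coord axis2 w, t)
  end.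

Definition ex_partial (i : axis) (f : R3 -> R) (w : R3) : Prop :=
  ex_derive (fun t => f (set_coord i w t)) (coord i w).

(* Meaningful at [w] only together with [ex_partial i f w]. *)
Definition partial (i : axis) (f : R3 -> R) (w : R3) : R :=
  Derive (fun t => f (set_coord i w t)) (coord i w).

(* [f] is of class C^n on [D]; only used for open [D], where the behaviour of
   [f] outside [D] is irrelevant. *)
Fixpoint class_C (n : nat) (D : R3 -> Prop) (f : R3 -> R) : Prop :=
  (forall w, D w -> continuous f w) /\
  match n with
  | O => True
  | S m => forall i : axis,
      (forall w, D w -> ex_partial i f w) /\ class_C m D (partial i f)
  end.

Definition smooth_on (D : R3 -> Prop) (f : R3 -> R) : Prop :=
  forall n : nat, class_C n D f.

Definition smooth_map_on (D : R3 -> Prop) (F : R3 -> R3) : Prop :=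
  forall i : axis, smooth_on D (fun w => coord i (F w)).

(* [F] restricts to a smooth bijection from the open set [W] onto the open set
   [V] with smooth inverse, i.e. the components of [F] are coordinates on [W],
   ranging over [V]. *)
Definition diffeomorphism (W V : R3 -> Prop) (F : R3 -> R3) : Prop :=
  open W /\ open V /\ smooth_map_on W F /\
  exists G : R3 -> R3,
    smooth_map_on V G /\
    (forall w, W w -> V (F w) /\ G (F w) = w) /\
    (forall v, V v -> W (G v) /\ F (G v) = v).

Definition in_interval (a b : Rbar) (y : R) : Prop :=
  Rbar_lt a y /\ Rbar_lt y b.

Definition smooth_on_interval (a b : Rbar) (f : R -> R) : Prop :=
  forall (n : nat) (y : R), in_interval a b y -> ex_derive_n f n y.

Definition antiderivative_on (a b : Rbar) (f F : R -> R) : Prop :=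
  forall y : R, in_interval a b y -> is_derive F y (f y).

(* In the next four definitions [beta] stands for the chosen antiderivative of
   B, and [gamma] for that of exp (-2 beta). *)
Definition X_of (beta : R -> R) (y p Z : R) : R :=
  - (8 * exp (- 2 * beta y) * Z ^ 3 * p) / (Z ^ 2 * p ^ 2 + 4) ^ 2.

Definition Y_of (beta gamma : R -> R) (y p Z : R) : R :=
  gamma y +
  exp (- 2 * beta y) * (- 2 * Z ^ 4 * p ^ 2 + 8 * Z ^ 2)
    / (Z ^ 2 * p ^ 2 + 4) ^ 2.

Definition U_of (beta : R -> R) (y p Z : R) : R :=
  ln ((Z ^ 2 * p ^ 2 + 4) ^ 3 / (64 * Z ^ 2)) + 4 * beta y.

Definition XYZ_of (beta gamma : R -> R) (w : R3) : R3 :=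
  let '(y, p, Z) := w in (X_of beta y p Z, Y_of beta gamma y p Z, Z).

(* Classical solution, in the coordinates (X, Y, Z) on the open set [D]. *)
Definition solves_SU_infty_Toda (D : R3 -> Prop) (u : R3 -> R) : Prop :=
  class_C 2 D u /\
  forall v, D v ->
    partial axis1 (partial axis1 u) v + partial axis2 (partial axis2 u) v
    = partial axis3 (partial axis3 (fun v' => exp (u v'))) v.

(* Main.v *)
Require Import Defs.
From Stdlib Require Import Reals Lra.
From Coquelicot Require Import Coquelicot.
Open Scope R_scope.

(** Write e = exp (- 2 beta), s = Z p / 2 and sigma = 1 + s^2.  In these
    variables the three relations become
      X = - e Z^2 s / sigma^2,
      Y = gamma + e Z^2 (1 - s^2) / (2 sigma^2),
      exp U = sigma^3 / (e^2 Z^2),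
    or, for the first two, X + i Y = i (gamma + e Z^2 / (2 (1 - i s)^2)).

    In the coordinates (X, Y, Z) the functions y and s satisfy the first two
    relations identically, so differentiating along each axis gives linear
    equations for the partial derivatives of y and s ([d_X], [d_Y]).  Because
    beta' = B and gamma' = e, the Jacobian of (y, s) |-> (X, Y) collapses to
    e^2 Z^2 K / sigma^3 with
      K = 1 - 3 s^2 - B Z^2   ([caustic]),
    which cannot vanish where (X, Y, Z) are coordinates ([caustic_neq_0]).
    Hence every first derivative of y and s is a rational function of
    (e, B, s, Z) with K as its only nontrivial denominator
    ([inverse_jacobian]), and so are U_X, U_Y and (exp U)_Z
    ([first_derivatives]).  Differentiating these once more, with
    e_i = - 2 B e y_i and B_i = B' y_i, turns the Toda equation into an identity
    between rational functions of (e, B, B', s, Z) ([toda_identity]).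

    Each partial derivative restricts a function to a line parallel to an
    axis, along which y, s and Z are functions of one real variable; the
    chain rule in one variable is therefore enough.  That U is of class C^2
    follows from closure of C^n under sums, products and composition with C^n
    functions of one variable, applied to U = 3 ln sigma - ln Z^2 + 4 beta(y). *)

(** * Partial derivatives *)

Definition is_partial (i : axis) (f : R3 -> R) (w : R3) (l : R) : Prop :=
  is_derive (fun t => f (set_coord i w t)) (coord i w) l.

Lemma set_coord_id (i : axis) (w : R3) : set_coord i w (coord i w) = w.
Proof. destruct i; destruct w as [[x y] z]; reflexivity. Qed.

(** Balls of the product uniform structure are boxes, so moving one coordinate
    by less than the radius stays inside. *)
Lemma open_along_axis (D : R3 -> Prop) (i : axis) (w : R3) :
  open D -> D w -> locally (coord i w) (fun t => D (set_coord i w t)).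
Proof.
  intros HD Hw.
  destruct (HD w Hw) as [eps Heps].
  exists eps; intros t Ht; apply Heps.
  destruct w as [[x y] z]; destruct i; simpl in *;
    (split; [split|]); simpl; first [exact Ht | apply ball_center].
Qed.

Lemma is_partial_ext_on (D : R3 -> Prop) (i : axis) (f g : R3 -> R)
  (w : R3) (l : R) :
  open D -> (forall v, D v -> f v = g v) -> D w ->
  is_partial i f w l -> is_partial i g w l.
Proof.
  intros HD Hfg Hw Hf.
  apply is_derive_ext_loc with (2 := Hf).
  generalize (open_along_axis D i w HD Hw); apply filter_imp.
  intros t Ht; exact (Hfg _ Ht).
Qed.

Lemma is_partial_correct (i : axis) (f : R3 -> R) (w : R3) :
  ex_partial i f w -> is_partial i f w (partial i f w).
Proof. intros H; exact (Derive_correct _ _ H). Qed.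

Lemma is_partial_ex (i : axis) (f : R3 -> R) (w : R3) (l : R) :
  is_partial i f w l -> ex_partial i f w.
Proof. intros H; exists l; exact H. Qed.

Lemma is_partial_unique (i : axis) (f : R3 -> R) (w : R3) (l : R) :
  is_partial i f w l -> partial i f w = l.
Proof. intros H; exact (is_derive_unique _ _ _ H). Qed.

Lemma is_partial_comp (i : axis) (g : R -> R) (f : R3 -> R) (w : R3)
  (m l : R) :
  is_derive g (f w) m -> is_partial i f w l ->
  is_partial i (fun v => g (f v)) w (m * l).
Proof.
  intros Hg Hf; unfold is_partial.
  rewrite Rmult_comm.
  apply (is_derive_comp g (fun t => f (set_coord i w t))).
  - now rewrite set_coord_id.
  - exact Hf.
Qed.

Lemma is_partial_plus (i : axis) (f g : R3 -> R) (w : R3) (l m : R) :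
  is_partial i f w l -> is_partial i g w m ->
  is_partial i (fun v => f v + g v) w (l + m).
Proof. intros Hf Hg; exact (is_derive_plus _ _ _ _ _ Hf Hg). Qed.

Lemma is_partial_mult (i : axis) (f g : R3 -> R) (w : R3) (l m : R) :
  is_partial i f w l -> is_partial i g w m ->
  is_partial i (fun v => f v * g v) w (l * g w + f w * m).
Proof.
  intros Hf Hg; unfold is_partial.
  generalize (is_derive_mult _ _ _ _ _ Hf Hg Rmult_comm).
  now rewrite set_coord_id.
Qed.

Definition kronecker (i j : axis) : R :=
  match i, j with
  | axis1, axis1 | axis2, axis2 | axis3, axis3 => 1
  | _, _ => 0
  end.

Lemma is_partial_coord (i j : axis) (w : R3) :
  is_partial i (coord j) w (kronecker i j).
Proof.
  destruct i, j; unfold is_partial; simpl;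
    auto_derive; reflexivity.
Qed.

(** The value is recorded next to the derivative so that the formulas below can
    be written in terms of values at the base point rather than of
    [f (set_coord i w (coord i w))]. *)
Definition jet (f : R -> R) (t f0 f1 : R) : Prop :=
  f t = f0 /\ is_derive f t f1.

Lemma is_partial_jet (i : axis) (f : R3 -> R) (w : R3) (l : R) :
  is_partial i f w l ->
  jet (fun t => f (set_coord i w t)) (coord i w) (f w) l.
Proof. intros H; split; [now rewrite set_coord_id | exact H]. Qed.

Arguments is_partial_jet {i f w l} _.

(** * Closure properties of class C^n *)

Lemma class_C_ext (n : nat) (D : R3 -> Prop) (f g : R3 -> R) :
  open D -> (forall v, D v -> f v = g v) -> class_C n D f -> class_C n D g.
Proof.
  intros HD; revert f g; induction n as [|n IH]; intros f g Hfg [Hc Hf];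
    (split; [intros w Hw; apply continuous_ext_loc with (2 := Hc w Hw);
             generalize (HD w Hw); apply filter_imp; exact Hfg|]).
  - exact I.
  - intros i; destruct (Hf i) as [Hex Hp]; split.
    + intros w Hw; apply is_partial_ex with (partial i f w).
      apply is_partial_ext_on with D f; auto.
      apply is_partial_correct; auto.
    + apply IH with (2 := Hp).
      intros w Hw; symmetry; apply is_partial_unique.
      apply is_partial_ext_on with D f; auto.
      apply is_partial_correct; auto.
Qed.

(** [class_C] speaks of [partial i f], a function defined on the whole space;
    on an open set it may be replaced by any function that agrees with it
    there. *)
Lemma class_C_S (n : nat) (D : R3 -> Prop) (f : R3 -> R)
  (df : axis -> R3 -> R) :
  open D -> (forall w, D w -> continuous f w) ->
  (forall i w, D w -> is_partial i f w (df i w)) ->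
  (forall i, class_C n D (df i)) -> class_C (S n) D f.
Proof.
  intros HD Hc Hp Hdf; split; [exact Hc|].
  intros i; split.
  - intros w Hw; exact (is_partial_ex _ _ _ _ (Hp i w Hw)).
  - apply class_C_ext with (df i); auto.
    intros w Hw; symmetry; apply is_partial_unique; auto.
Qed.

Lemma class_C_is_partial (n : nat) (D : R3 -> Prop) (f : R3 -> R) :
  class_C (S n) D f ->
  forall i w, D w -> is_partial i f w (partial i f w).
Proof.
  intros [_ H] i w Hw; apply is_partial_correct; now apply (H i).
Qed.

Lemma class_C_pred (n : nat) (D : R3 -> Prop) (f : R3 -> R) :
  class_C (S n) D f -> class_C n D f.
Proof.
  revert f; induction n as [|n IH]; intros f [Hc Hf]; split; auto.
  intros i; destruct (Hf i) as [Hex Hp]; auto.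
Qed.

Lemma class_C_const (n : nat) (D : R3 -> Prop) (c : R) :
  open D -> class_C n D (fun _ => c).
Proof.
  intros HD; revert c; induction n as [|n IH]; intros c.
  - split; [intros; apply continuous_const | exact I].
  - apply class_C_S with (fun _ _ => 0); auto.
    + intros; apply continuous_const.
    + intros; unfold is_partial; auto_derive; reflexivity.
Qed.

Lemma continuous_coord (i : axis) (w : R3) : continuous (coord i) w.
Proof.
  destruct w as [[x y] z]; destruct i; simpl.
  - apply (continuous_comp fst fst); apply continuous_fst.
  - apply (continuous_comp fst snd); [apply continuous_fst | apply continuous_snd].
  - apply continuous_snd.
Qed.

Lemma class_C_coord (n : nat) (D : R3 -> Prop) (j : axis) :
  open D -> class_C n D (coord j).
Proof.
  intros HD; destruct n as [|n].
  - split; [intros; apply continuous_coord | exact I].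
  - apply class_C_S with (fun i _ => kronecker i j); auto.
    + intros; apply continuous_coord.
    + intros; apply is_partial_coord.
    + intros; now apply class_C_const.
Qed.

Lemma class_C_plus (n : nat) (D : R3 -> Prop) (f g : R3 -> R) :
  open D -> class_C n D f -> class_C n D g ->
  class_C n D (fun v => f v + g v).
Proof.
  intros HD; revert f g; induction n as [|n IH]; intros f g Hf Hg.
  - split; [|exact I]; intros w Hw.
    apply (continuous_plus f g); [now apply Hf | now apply Hg].
  - apply class_C_S with (fun i v => partial i f v + partial i g v); auto.
    + intros w Hw; apply (continuous_plus f g); [now apply Hf | now apply Hg].
    + intros i w Hw; apply is_partial_plus; eapply class_C_is_partial; eauto.
    + intros i; apply IH; [apply Hf | apply Hg].
Qed.

Lemma class_C_mult (n : nat) (D : R3 -> Prop) (f g : R3 -> R) :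
  open D -> class_C n D f -> class_C n D g ->
  class_C n D (fun v => f v * g v).
Proof.
  intros HD; revert f g; induction n as [|n IH]; intros f g Hf Hg.
  - split; [|exact I]; intros w Hw.
    apply (continuous_mult f g); [now apply Hf | now apply Hg].
  - apply class_C_S with
      (fun i v => partial i f v * g v + f v * partial i g v); auto.
    + intros w Hw; apply (continuous_mult f g); [now apply Hf | now apply Hg].
    + intros i w Hw; apply is_partial_mult; eapply class_C_is_partial; eauto.
    + intros i; apply class_C_plus; auto; apply IH;
        solve [now apply class_C_pred | apply Hf | apply Hg].
Qed.

(** The derivative is existentially quantified, so that a function may be
    given an explicit derivative valid on [I] only, such as [/ x] for [ln] or
    [f] for an antiderivative of [f]. *)
Fixpoint class_C1 (n : nat) (I : R -> Prop) (g : R -> R) : Prop :=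
  (forall x, I x -> continuous g x) /\
  match n with
  | O => True
  | S m => exists dg : R -> R,
      (forall x, I x -> is_derive g x (dg x)) /\ class_C1 m I dg
  end.

Lemma class_C_comp (n : nat) (D : R3 -> Prop) (I : R -> Prop)
  (g : R -> R) (f : R3 -> R) :
  open D -> (forall w, D w -> I (f w)) ->
  class_C1 n I g -> class_C n D f -> class_C n D (fun v => g (f v)).
Proof.
  intros HD HI; revert g; induction n as [|n IH]; intros g Hg Hf;
    assert (Hc : forall w, D w -> continuous (fun v => g (f v)) w)
      by (intros w Hw; apply (continuous_comp f g);
          [now apply Hf | now apply Hg, HI]).
  - now split.
  - destruct Hg as [_ [dg [Hdg HCdg]]].
    apply class_C_S with (fun i v => dg (f v) * partial i f v); auto.
    + intros i w Hw; apply is_partial_comp; auto.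
      eapply class_C_is_partial; eauto.
    + intros i; apply class_C_mult; auto.
      * apply IH; auto; now apply class_C_pred.
      * apply Hf.
Qed.

Lemma class_C1_ln : class_C1 2 (fun x => 0 < x) ln.
Proof.
  assert (Hc : forall (g : R -> R) x, ex_derive g x -> continuous g x)
    by (intros; now apply (ex_derive_continuous (V := R_NormedModule))).
  assert (H0 : forall x, 0 < x -> is_derive ln x (/ x))
    by (intros x Hx; auto_derive; [exact Hx | ring]).
  assert (H1 : forall x, 0 < x -> is_derive (fun x => / x) x (- / x ^ 2))
    by (intros x Hx; auto_derive; [lra | field; lra]).
  split; [intros x Hx; apply Hc; eexists; eauto|].
  exists (fun x => / x); split; [exact H0|].
  split; [intros x Hx; apply Hc; eexists; apply H1; auto|].
  exists (fun x => - / x ^ 2); split; [exact H1|].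
  split; [|exact I]; intros x Hx; apply Hc.
  auto_derive; apply Rgt_not_eq; nra.
Qed.

(** The derivatives of [F] are [f] and [Derive f]; the last is continuous
    because [f] is twice differentiable. *)
Lemma class_C1_antiderivative (a b : Rbar) (f F : R -> R) :
  smooth_on_interval a b f -> antiderivative_on a b f F ->
  class_C1 2 (in_interval a b) F.
Proof.
  assert (Hc : forall (g : R -> R) x, ex_derive g x -> continuous g x)
    by (intros; now apply (ex_derive_continuous (V := R_NormedModule))).
  intros Hf HF.
  split; [intros x Hx; apply Hc; eexists; now apply HF|].
  exists f; split; [exact HF|].
  split; [intros x Hx; apply Hc; exact (Hf 1%nat x Hx)|].
  exists (Derive f); split.
  - intros x Hx; apply Derive_correct; exact (Hf 1%nat x Hx).
  - split; [|exact I]; intros x Hx; apply Hc; exact (Hf 2%nat x Hx).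
Qed.

(** * The relations in terms of the slope *)

Definition X_slope (e s z : R) : R :=
  - (e * z ^ 2 * s) / (1 + s ^ 2) ^ 2.

Definition Y_slope (g e s z : R) : R :=
  g + e * z ^ 2 * (1 - s ^ 2) / (2 * (1 + s ^ 2) ^ 2).

Definition U_slope (b s z : R) : R :=
  3 * ln (1 + s ^ 2) - ln (z ^ 2) + 4 * b.

Definition exp_U_slope (e s z : R) : R :=
  (1 + s ^ 2) ^ 3 / (e ^ 2 * z ^ 2).

Lemma one_plus_sqr_pos (x : R) : 0 < 1 + x ^ 2.
Proof. generalize (pow2_ge_0 x); lra. Qed.

Lemma X_of_slope (beta : R -> R) (y p z : R) :
  X_of beta y p z = X_slope (exp (- 2 * beta y)) (z * p / 2) z.
Proof. unfold X_of, X_slope; field; nra. Qed.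

Lemma Y_of_slope (beta gamma : R -> R) (y p z : R) :
  Y_of beta gamma y p z
  = Y_slope (gamma y) (exp (- 2 * beta y)) (z * p / 2) z.
Proof. unfold Y_of, Y_slope; field; nra. Qed.

Lemma U_of_slope (beta : R -> R) (y p z : R) :
  z <> 0 -> U_of beta y p z = U_slope (beta y) (z * p / 2) z.
Proof.
  intros Hz; unfold U_of, U_slope.
  assert (0 < z ^ 2) by (apply pow2_gt_0; exact Hz).
  pose proof (one_plus_sqr_pos (z * p / 2)).
  replace ((z ^ 2 * p ^ 2 + 4) ^ 3 / (64 * z ^ 2))
    with ((1 + (z * p / 2) ^ 2) ^ 3 * / z ^ 2) by (field; exact Hz).
  rewrite ln_mult, ln_Rinv, ln_pow; auto using pow_lt, Rinv_0_lt_compat.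
  simpl (INR 3); ring.
Qed.

Lemma exp_U_slopeE (b s z : R) :
  z <> 0 -> exp (U_slope b s z) = exp_U_slope (exp (- 2 * b)) s z.
Proof.
  intros Hz; unfold U_slope, exp_U_slope.
  assert (0 < z ^ 2) by (apply pow2_gt_0; exact Hz).
  pose proof (one_plus_sqr_pos s).
  replace (3 * ln (1 + s ^ 2)) with (ln ((1 + s ^ 2) ^ 3))
    by (rewrite ln_pow by assumption; simpl (INR 3); ring).
  replace (4 * b) with (- (- 2 * b + - 2 * b)) by ring.
  unfold Rminus; rewrite !exp_plus, !exp_Ropp, exp_plus.
  rewrite !exp_ln by (assumption || (apply pow_lt; assumption)).
  field; split; [exact Hz | apply Rgt_not_eq, exp_pos].
Qed.

(** [d_X], [d_Y] and [d_U] are the differentials of [X_slope], [Y_slope] and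
    [U_slope]: the arguments ending in 1 are the derivatives of the
    corresponding variables along a curve. *)
Definition d_X (e s z e1 s1 z1 : R) : R :=
  - (e1 * z ^ 2 * s + 2 * e * z * z1 * s) / (1 + s ^ 2) ^ 2
  - e * z ^ 2 * (1 - 3 * s ^ 2) / (1 + s ^ 2) ^ 3 * s1.

Definition d_Y (e s z g1 e1 s1 z1 : R) : R :=
  g1 + (e1 * z ^ 2 + 2 * e * z * z1) * (1 - s ^ 2) / (2 * (1 + s ^ 2) ^ 2)
  - e * z ^ 2 * s * (3 - s ^ 2) / (1 + s ^ 2) ^ 3 * s1.

Definition d_U (s z b1 s1 z1 : R) : R :=
  6 * s * s1 / (1 + s ^ 2) - 2 * z1 / z + 4 * b1.

(* The second alternative is for products of factors that are nonzero by
   hypothesis, the trailing 1 of an unfolded power included. *)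
Ltac nonzero :=
  solve [nra | repeat apply Rmult_integral_contrapositive_currified;
               auto using R1_neq_R0].

Ltac derive_along_jets t :=
  repeat match goal with
  | H : jet _ t _ _ |- _ => destruct H as [<- H]
  end;
  auto_derive;
  [ repeat split; try (eexists; eassumption); nonzero
  | repeat match goal with
    | H : is_derive _ t ?l |- context [Derive ?g t] =>
        replace (Derive g t) with l
          by (symmetry; exact (is_derive_unique _ _ _ H))
    end; field; repeat split; nonzero ].

Lemma is_derive_X_slope (e s z : R -> R) (t e0 s0 z0 e1 s1 z1 : R) :
  jet e t e0 e1 -> jet s t s0 s1 -> jet z t z0 z1 ->
  is_derive (fun t => X_slope (e t) (s t) (z t)) t (d_X e0 s0 z0 e1 s1 z1).
Proof. intros; unfold X_slope, d_X; derive_along_jets t. Qed.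

Lemma is_derive_Y_slope (g e s z : R -> R)
  (t g0 e0 s0 z0 g1 e1 s1 z1 : R) :
  jet g t g0 g1 -> jet e t e0 e1 -> jet s t s0 s1 -> jet z t z0 z1 ->
  is_derive (fun t => Y_slope (g t) (e t) (s t) (z t)) t
    (d_Y e0 s0 z0 g1 e1 s1 z1).
Proof. intros; unfold Y_slope, d_Y; derive_along_jets t. Qed.

Lemma is_derive_U_slope (b s z : R -> R) (t b0 s0 z0 b1 s1 z1 : R) :
  z0 <> 0 ->
  jet b t b0 b1 -> jet s t s0 s1 -> jet z t z0 z1 ->
  is_derive (fun t => U_slope (b t) (s t) (z t)) t (d_U s0 z0 b1 s1 z1).
Proof. intros; unfold U_slope, d_U; derive_along_jets t. Qed.

(** * The inverse Jacobian *)

(** Up to the nonvanishing factor e^2 z^2 / (1 + s^2)^3, the Jacobian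
    determinant of (y, s) |-> (X, Y) at fixed z; its zero set is where the chart
    folds. *)
Definition caustic (B s z : R) : R := 1 - 3 * s ^ 2 - B * z ^ 2.

(** Cramer's rule, with a factor e z^2 / (1 + s^2)^3 cancelled in the equation
    for y1 and e / (1 + s^2)^3 in the one for s1.  It does not presuppose that
    the determinant is nonzero, and so also serves to prove that. *)
Lemma d_X_d_Y_solve (e B s z y1 s1 z1 : R) :
  e <> 0 -> z <> 0 ->
  let x' := d_X e s z (- 2 * B * y1 * e) s1 z1 in
  let y' := d_Y e s z (e * y1) (- 2 * B * y1 * e) s1 z1 in
  e * caustic B s z * y1
    = - s * (3 - s ^ 2) * x' + (1 - 3 * s ^ 2) * y' - e * z * z1 /\
  e * z ^ 2 * caustic B s z * s1
    = (1 + s ^ 2) *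
      (- ((1 + s ^ 2) ^ 2 - B * z ^ 2 * (1 - s ^ 2)) * x'
       + 2 * B * z ^ 2 * s * y' - 2 * e * z * s * z1).
Proof.
  intros He Hz x' y'; unfold x', y', d_X, d_Y, caustic.
  split; field; nra.
Qed.

(** If the determinant vanished, Cramer's rule for the right-hand sides (1, 0)
    and (0, 1) would make s (3 - s^2) and 1 - 3 s^2 vanish together.  They are
    the imaginary and real parts of (1 + i s)^3, whose squared modulus
    (1 + s^2)^3 is positive. *)
Lemma caustic_neq_0 (e B s z yX sX yY sY : R) :
  e <> 0 -> z <> 0 ->
  d_X e s z (- 2 * B * yX * e) sX 0 = 1 ->
  d_Y e s z (e * yX) (- 2 * B * yX * e) sX 0 = 0 ->
  d_X e s z (- 2 * B * yY * e) sY 0 = 0 ->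
  d_Y e s z (e * yY) (- 2 * B * yY * e) sY 0 = 1 ->
  caustic B s z <> 0.
Proof.
  intros He Hz H1 H2 H3 H4 HK.
  destruct (d_X_d_Y_solve e B s z yX sX 0 He Hz) as [E1 _].
  destruct (d_X_d_Y_solve e B s z yY sY 0 He Hz) as [E2 _].
  rewrite H1, H2, HK in E1; rewrite H3, H4, HK in E2.
  assert (F1 : s * (3 - s ^ 2) = 0) by lra.
  assert (F2 : 1 - 3 * s ^ 2 = 0) by lra.
  assert (F3 : (1 + s ^ 2) ^ 3 = (1 - 3 * s ^ 2) ^ 2 + (s * (3 - s ^ 2)) ^ 2)
    by ring.
  rewrite F1, F2 in F3.
  pose proof (pow_lt _ 3 (one_plus_sqr_pos s)).
  lra.
Qed.

(** The partial derivatives of y and s with respect to X, Y and Z, in this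
    order of the axes. *)
Definition y_i (i : axis) (e B s z : R) : R :=
  match i with
  | axis1 => - s * (3 - s ^ 2) / (e * caustic B s z)
  | axis2 => (1 - 3 * s ^ 2) / (e * caustic B s z)
  | axis3 => - z / caustic B s z
  end.

Definition s_i (i : axis) (e B s z : R) : R :=
  match i with
  | axis1 =>
      - (1 + s ^ 2) * ((1 + s ^ 2) ^ 2 - B * z ^ 2 * (1 - s ^ 2))
      / (e * z ^ 2 * caustic B s z)
  | axis2 => 2 * B * s * (1 + s ^ 2) / (e * caustic B s z)
  | axis3 => - 2 * s * (1 + s ^ 2) / (z * caustic B s z)
  end.

Lemma inverse_jacobian (i : axis) (e B s z y1 s1 : R) :
  e <> 0 -> z <> 0 -> caustic B s z <> 0 ->
  d_X e s z (- 2 * B * y1 * e) s1 (kronecker i axis3) = kronecker i axis1 ->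
  d_Y e s z (e * y1) (- 2 * B * y1 * e) s1 (kronecker i axis3)
    = kronecker i axis2 ->
  y1 = y_i i e B s z /\ s1 = s_i i e B s z.
Proof.
  intros He Hz HK HX HY.
  destruct (d_X_d_Y_solve e B s z y1 s1 (kronecker i axis3) He Hz) as [Ey Es].
  rewrite HX, HY in Ey, Es.
  split.
  - apply Rmult_eq_reg_l with (e * caustic B s z);
      [rewrite Ey; destruct i; simpl; field; auto | nonzero].
  - apply Rmult_eq_reg_l with (e * z ^ 2 * caustic B s z);
      [rewrite Es; destruct i; simpl; field; auto | nonzero].
Qed.

(** * The first derivatives of the solution *)

Definition u_X (e B s z : R) : R :=
  s * (2 * (3 + s ^ 2) - 4 * (3 - s ^ 2) / caustic B s z) / (e * z ^ 2).

Definition u_Y (e B s z : R) : R :=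
  (4 * (1 - 3 * s ^ 2) / caustic B s z - 4) / (e * z ^ 2).

Definition exp_u_Z (e B s z : R) : R :=
  (1 + s ^ 2) ^ 3 * (2 - 4 / caustic B s z) / (e ^ 2 * z ^ 3).

Lemma first_derivatives (e B s z : R) :
  e <> 0 -> z <> 0 -> caustic B s z <> 0 ->
  let u_i i :=
    d_U s z (B * y_i i e B s z) (s_i i e B s z) (kronecker i axis3) in
  u_i axis1 = u_X e B s z /\
  u_i axis2 = u_Y e B s z /\
  exp_U_slope e s z * u_i axis3 = exp_u_Z e B s z.
Proof.
  unfold caustic; intros He Hz HK.
  unfold exp_U_slope, u_X, u_Y, exp_u_Z, d_U, y_i, s_i, caustic, kronecker.
  repeat split; field; repeat split; nonzero.
Qed.

Definition d_caustic (B s z B1 s1 z1 : R) : R :=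
  - 6 * s * s1 - B1 * z ^ 2 - 2 * B * z * z1.

(** Differentials along a curve, as for [d_X]; now B varies too. *)
Definition d_u_X (e B s z e1 B1 s1 z1 : R) : R :=
  (6 * (1 + s ^ 2) - 12 * (1 - s ^ 2) / caustic B s z) * s1 / (e * z ^ 2)
  + 4 * s * (3 - s ^ 2) * d_caustic B s z B1 s1 z1
    / (caustic B s z ^ 2 * e * z ^ 2)
  - u_X e B s z * (e1 / e + 2 * z1 / z).

Definition d_u_Y (e B s z e1 B1 s1 z1 : R) : R :=
  - 24 * s * s1 / (caustic B s z * e * z ^ 2)
  - 4 * (1 - 3 * s ^ 2) * d_caustic B s z B1 s1 z1
    / (caustic B s z ^ 2 * e * z ^ 2)
  - u_Y e B s z * (e1 / e + 2 * z1 / z).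

Definition d_exp_u_Z (e B s z e1 B1 s1 z1 : R) : R :=
  6 * s * (1 + s ^ 2) ^ 2 * (2 - 4 / caustic B s z) * s1 / (e ^ 2 * z ^ 3)
  + 4 * (1 + s ^ 2) ^ 3 * d_caustic B s z B1 s1 z1
    / (caustic B s z ^ 2 * e ^ 2 * z ^ 3)
  - exp_u_Z e B s z * (2 * e1 / e + 3 * z1 / z).

Lemma is_derive_u_X (e B s z : R -> R)
  (t e0 B0 s0 z0 e1 B1 s1 z1 : R) :
  e0 <> 0 -> z0 <> 0 -> caustic B0 s0 z0 <> 0 ->
  jet e t e0 e1 -> jet B t B0 B1 -> jet s t s0 s1 -> jet z t z0 z1 ->
  is_derive (fun t => u_X (e t) (B t) (s t) (z t)) t
    (d_u_X e0 B0 s0 z0 e1 B1 s1 z1).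
Proof.
  unfold d_u_X, u_X, d_caustic, caustic; intros; derive_along_jets t.
Qed.

Lemma is_derive_u_Y (e B s z : R -> R)
  (t e0 B0 s0 z0 e1 B1 s1 z1 : R) :
  e0 <> 0 -> z0 <> 0 -> caustic B0 s0 z0 <> 0 ->
  jet e t e0 e1 -> jet B t B0 B1 -> jet s t s0 s1 -> jet z t z0 z1 ->
  is_derive (fun t => u_Y (e t) (B t) (s t) (z t)) t
    (d_u_Y e0 B0 s0 z0 e1 B1 s1 z1).
Proof.
  unfold d_u_Y, u_Y, d_caustic, caustic; intros; derive_along_jets t.
Qed.

Lemma is_derive_exp_u_Z (e B s z : R -> R)
  (t e0 B0 s0 z0 e1 B1 s1 z1 : R) :
  e0 <> 0 -> z0 <> 0 -> caustic B0 s0 z0 <> 0 ->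
  jet e t e0 e1 -> jet B t B0 B1 -> jet s t s0 s1 -> jet z t z0 z1 ->
  is_derive (fun t => exp_u_Z (e t) (B t) (s t) (z t)) t
    (d_exp_u_Z e0 B0 s0 z0 e1 B1 s1 z1).
Proof.
  unfold d_exp_u_Z, exp_u_Z, d_caustic, caustic; intros; derive_along_jets t.
Qed.

(** [along d i] is the derivative along axis i, obtained by inserting the
    partial derivatives of e, B, s and z; [B1] stands for the derivative of B
    with respect to y.  The terms in [B1] already show the
    mechanism: on the left they are
    4 B1 ((1 - 3 s^2)^2 + s^2 (3 - s^2)^2) / (e^2 K^3), on the right
    4 B1 (1 + s^2)^3 / (e^2 K^3), and both numerators contain the squared
    modulus of (1 + i s)^3. *)
Lemma toda_identity (e B B1 s z : R) :
  e <> 0 -> z <> 0 -> caustic B s z <> 0 ->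
  let along (d : R -> R -> R -> R -> R -> R -> R -> R -> R) (i : axis) :=
    d e B s z (- 2 * B * y_i i e B s z * e) (B1 * y_i i e B s z)
      (s_i i e B s z) (kronecker i axis3) in
  along d_u_X axis1 + along d_u_Y axis2 = along d_exp_u_Z axis3.
Proof.
  unfold caustic; intros He Hz HK.
  unfold d_u_X, d_u_Y, d_exp_u_Z, u_X, u_Y, exp_u_Z, d_caustic, y_i, s_i,
    caustic, kronecker.
  field; auto.
Qed.

(** * The solution on the image of the chart *)

(** The inverse chart, reduced to what the computation uses: y and the slope s
    as functions of (X, Y, Z) that solve the first two relations. *)
Record hodograph (a b : Rbar) (beta gamma : R -> R) (V : R3 -> Prop)
  (y s : R3 -> R) : Prop := {
  hodograph_open : open V;
  hodograph_interval : forall v, V v -> in_interval a b (y v);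
  hodograph_Z : forall v, V v -> coord axis3 v <> 0;
  hodograph_y : class_C 2 V y;
  hodograph_s : class_C 2 V s;
  hodograph_X : forall v, V v ->
    X_slope (exp (- 2 * beta (y v))) (s v) (coord axis3 v) = coord axis1 v;
  hodograph_Y : forall v, V v ->
    Y_slope (gamma (y v)) (exp (- 2 * beta (y v))) (s v) (coord axis3 v)
    = coord axis2 v
}.

Arguments hodograph_open {a b beta gamma V y s} _.
Arguments hodograph_interval {a b beta gamma V y s} _ {v} _.
Arguments hodograph_Z {a b beta gamma V y s} _ {v} _.
Arguments hodograph_y {a b beta gamma V y s} _.
Arguments hodograph_s {a b beta gamma V y s} _.
Arguments hodograph_X {a b beta gamma V y s} _ {v} _.
Arguments hodograph_Y {a b beta gamma V y s} _ {v} _.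

Lemma diffeomorphism_hodograph (a b : Rbar) (beta gamma : R -> R)
  (W V : R3 -> Prop) :
  (forall y p Z : R, W (y, p, Z) -> in_interval a b y /\ Z <> 0) ->
  diffeomorphism W V (XYZ_of beta gamma) ->
  exists y p : R3 -> R,
    hodograph a b beta gamma V y (fun v => coord axis3 v * p v / 2) /\
    forall v, V v ->
      W (y v, p v, coord axis3 v) /\
      v = (X_of beta (y v) (p v) (coord axis3 v),
           Y_of beta gamma (y v) (p v) (coord axis3 v), coord axis3 v).
Proof.
  intros hW [_ [HV [_ [G [HG [_ HGF]]]]]].
  exists (fun v => coord axis1 (G v)), (fun v => coord axis2 (G v)).
  assert (H : forall v, V v ->
      W (coord axis1 (G v), coord axis2 (G v), coord axis3 v) /\
      v = (X_of beta (coord axis1 (G v)) (coord axis2 (G v)) (coord axis3 v),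
           Y_of beta gamma (coord axis1 (G v)) (coord axis2 (G v))
             (coord axis3 v),
           coord axis3 v)).
  { intros v Hv; destruct (HGF v Hv) as [HW HF].
    destruct (G v) as [[y p] Z]; simpl in HF |- *.
    rewrite <- HF; simpl; auto. }
  split; [split | exact H].
  - exact HV.
  - intros v Hv; exact (proj1 (hW _ _ _ (proj1 (H v Hv)))).
  - intros v Hv; exact (proj2 (hW _ _ _ (proj1 (H v Hv)))).
  - apply (HG axis1).
  - apply class_C_mult; auto using class_C_const.
    apply class_C_mult; auto using class_C_coord; apply (HG axis2).
  - intros v Hv; rewrite <- X_of_slope.
    exact (eq_sym (f_equal (coord axis1) (proj2 (H v Hv)))).
  - intros v Hv; rewrite <- Y_of_slope.
    exact (eq_sym (f_equal (coord axis2) (proj2 (H v Hv)))).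
Qed.

(** The squares are written as products, and the difference as a sum, to match
    the closure lemmas. *)
Lemma class_C_U_slope (a b : Rbar) (B beta gamma : R -> R)
  (V : R3 -> Prop) (y s : R3 -> R) :
  smooth_on_interval a b B -> antiderivative_on a b B beta ->
  hodograph a b beta gamma V y s ->
  class_C 2 V (fun v => U_slope (beta (y v)) (s v) (coord axis3 v)).
Proof.
  intros HB Hbeta Hyp.
  pose proof (hodograph_open Hyp) as HV.
  assert (Hln : forall f : R3 -> R, (forall v, V v -> 0 < f v) ->
            class_C 2 V f -> class_C 2 V (fun v => ln (f v)))
    by (intros f Hf Cf;
        exact (class_C_comp 2 V _ ln f HV Hf class_C1_ln Cf)).
  apply class_C_ext with
    (fun v => 3 * ln (1 + s v * s v)
              + - 1 * ln (coord axis3 v * coord axis3 v) + 4 * beta (y v));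
    [exact HV | |].
  { intros v _; unfold U_slope; simpl; rewrite !Rmult_1_r; ring. }
  apply class_C_plus; [exact HV | apply class_C_plus; [exact HV | |] |];
    (apply class_C_mult; [exact HV | now apply class_C_const |]).
  - apply (Hln (fun v => 1 + s v * s v)); [intros v _; nra|].
    pose proof (hodograph_s Hyp).
    apply class_C_plus; auto using class_C_const, class_C_mult.
  - apply (Hln (fun v => coord axis3 v * coord axis3 v));
      [intros v Hv; pose proof (hodograph_Z Hyp Hv); nra|].
    auto using class_C_mult, class_C_coord.
  - apply class_C_comp with (in_interval a b); auto.
    + intros v Hv; exact (hodograph_interval Hyp Hv).
    + now apply class_C1_antiderivative with B.
    + exact (hodograph_y Hyp).
Qed.

Lemma is_partial_exp_beta (a b : Rbar) (B beta : R -> R) (y : R3 -> R)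
  (i : axis) (v : R3) (l : R) :
  antiderivative_on a b B beta -> in_interval a b (y v) ->
  is_partial i y v l ->
  is_partial i (fun w => exp (- 2 * beta (y w))) v
    (- 2 * B (y v) * l * exp (- 2 * beta (y v))).
Proof.
  intros Hbeta Hv Hy.
  replace (- 2 * B (y v) * l * exp (- 2 * beta (y v)))
    with (exp (- 2 * beta (y v)) * (- 2 * (B (y v) * l))) by ring.
  apply (is_partial_comp i exp); [apply is_derive_exp|].
  apply (is_partial_comp i (Rmult (- 2))).
  - auto_derive; [exact I | ring].
  - apply is_partial_comp; auto.
Qed.

(** Along each axis the relations [hodograph_X] and [hodograph_Y] equate a
    function of y, s and z with a coordinate, whose derivative is 0 or 1; this
    is the linear system inverted by [inverse_jacobian].  The axes X and Y give
    the two right-hand sides needed for [caustic_neq_0]. *)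
Lemma hodograph_partials (a b : Rbar) (B beta gamma : R -> R)
  (V : R3 -> Prop) (y s : R3 -> R) :
  antiderivative_on a b B beta ->
  antiderivative_on a b (fun y => exp (- 2 * beta y)) gamma ->
  hodograph a b beta gamma V y s ->
  forall v, V v ->
  let e := exp (- 2 * beta (y v)) in
  let z := coord axis3 v in
  caustic (B (y v)) (s v) z <> 0 /\
  forall i, is_partial i y v (y_i i e (B (y v)) (s v) z) /\
            is_partial i s v (s_i i e (B (y v)) (s v) z).
Proof.
  intros Hbeta Hgamma Hyp v Hv e z.
  pose proof (hodograph_interval Hyp Hv) as Hint.
  assert (He : e <> 0) by (apply Rgt_not_eq, exp_pos).
  pose proof (hodograph_Z Hyp Hv : z <> 0) as Hz.
  pose proof (fun i => class_C_is_partial _ _ _ (hodograph_y Hyp) i v Hv) as Dy.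
  pose proof (fun i => class_C_is_partial _ _ _ (hodograph_s Hyp) i v Hv) as Ds.
  assert (De := fun i =>
    is_partial_exp_beta _ _ _ _ _ _ _ _ Hbeta Hint (Dy i)).
  assert (Dg := fun i => is_partial_comp i gamma y v _ _ (Hgamma _ Hint) (Dy i)).
  assert (HX : forall i,
    d_X e (s v) z (- 2 * B (y v) * partial i y v * e) (partial i s v)
      (kronecker i axis3) = kronecker i axis1).
  { intros i.
    rewrite <- (is_partial_unique _ _ _ _ (is_partial_coord i axis1 v)).
    symmetry; apply is_partial_unique.
    apply is_partial_ext_on with (2 := @hodograph_X _ _ _ _ _ _ _ Hyp);
      [exact (hodograph_open Hyp) | exact Hv |].
    exact (is_derive_X_slope _ _ _ _ _ _ _ _ _ _
      (is_partial_jet (De i)) (is_partial_jet (Ds i))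
      (is_partial_jet (is_partial_coord i axis3 v))). }
  assert (HY : forall i,
    d_Y e (s v) z (e * partial i y v) (- 2 * B (y v) * partial i y v * e)
      (partial i s v) (kronecker i axis3) = kronecker i axis2).
  { intros i.
    rewrite <- (is_partial_unique _ _ _ _ (is_partial_coord i axis2 v)).
    symmetry; apply is_partial_unique.
    apply is_partial_ext_on with (2 := @hodograph_Y _ _ _ _ _ _ _ Hyp);
      [exact (hodograph_open Hyp) | exact Hv |].
    exact (is_derive_Y_slope _ _ _ _ _ _ _ _ _ _ _ _ _
      (is_partial_jet (Dg i)) (is_partial_jet (De i))
      (is_partial_jet (Ds i))
      (is_partial_jet (is_partial_coord i axis3 v))). }
  assert (HK : caustic (B (y v)) (s v) z <> 0)
    by exact (caustic_neq_0 _ _ _ _ _ _ _ _ He Hz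
                (HX axis1) (HY axis1) (HX axis2) (HY axis2)).
  split; [exact HK|].
  intros i.
  destruct (inverse_jacobian i _ _ _ _ _ _ He Hz HK (HX i) (HY i)) as [Ey Es].
  rewrite <- Ey, <- Es; auto.
Qed.

Lemma hodograph_toda (a b : Rbar) (B beta gamma : R -> R)
  (V : R3 -> Prop) (y s u : R3 -> R) :
  smooth_on_interval a b B ->
  antiderivative_on a b B beta ->
  antiderivative_on a b (fun y => exp (- 2 * beta y)) gamma ->
  hodograph a b beta gamma V y s ->
  (forall v, V v -> U_slope (beta (y v)) (s v) (coord axis3 v) = u v) ->
  solves_SU_infty_Toda V u.
Proof.
  intros HB Hbeta Hgamma Hyp Hu.
  pose proof (hodograph_open Hyp) as HV.
  split.
  { apply class_C_ext with (2 := Hu); [exact HV|].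
    exact (class_C_U_slope a b B beta gamma V y s HB Hbeta Hyp). }
  set (e := fun v => exp (- 2 * beta (y v))).
  set (b' := fun v => B (y v)).
  set (z := coord axis3).
  set (yi := fun i v => y_i i (e v) (b' v) (s v) (z v)).
  set (si := fun i v => s_i i (e v) (b' v) (s v) (z v)).
  assert (He : forall v, e v <> 0) by (intros v; apply Rgt_not_eq, exp_pos).
  assert (Hz : forall v, V v -> z v <> 0)
    by (intros v Hv; exact (hodograph_Z Hyp Hv)).
  assert (Hys := hodograph_partials _ _ _ _ _ _ _ _ Hbeta Hgamma Hyp).
  assert (HK : forall v, V v -> caustic (b' v) (s v) (z v) <> 0)
    by (intros v Hv; exact (proj1 (Hys v Hv))).
  assert (Dy : forall i v, V v -> is_partial i y v (yi i v))
    by (intros i v Hv; exact (proj1 (proj2 (Hys v Hv) i))).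
  assert (Ds : forall i v, V v -> is_partial i s v (si i v))
    by (intros i v Hv; exact (proj2 (proj2 (Hys v Hv) i))).
  assert (Dz : forall i v, is_partial i z v (kronecker i axis3))
    by (intros; apply is_partial_coord).
  assert (De : forall i v, V v ->
            is_partial i e v (- 2 * b' v * yi i v * e v))
    by (intros i v Hv; apply (is_partial_exp_beta a b); auto;
        exact (hodograph_interval Hyp Hv)).
  assert (Db : forall i v, V v ->
            is_partial i b' v (Derive B (y v) * yi i v))
    by (intros i v Hv; apply is_partial_comp; auto; apply Derive_correct;
        exact (HB 1%nat _ (hodograph_interval Hyp Hv))).
  assert (Du : forall i v, V v -> is_partial i u v
            (d_U (s v) (z v) (b' v * yi i v) (si i v) (kronecker i axis3))).
  { intros i v Hv; apply is_partial_ext_on with (2 := Hu); auto.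
    assert (Dbeta := is_partial_comp i beta y v _ _
                       (Hbeta _ (hodograph_interval Hyp Hv)) (Dy i v Hv)).
    exact (is_derive_U_slope _ _ _ _ _ _ _ _ _ _ (Hz v Hv)
      (is_partial_jet Dbeta) (is_partial_jet (Ds i v Hv))
      (is_partial_jet (Dz i v))). }
  assert (H1 := fun v Hv => first_derivatives _ _ _ _ (He v) (Hz v Hv) (HK v Hv)).
  assert (HuX : forall v, V v ->
            u_X (e v) (b' v) (s v) (z v) = partial axis1 u v).
  { intros v Hv; rewrite (is_partial_unique _ _ _ _ (Du axis1 v Hv)).
    symmetry; apply (H1 v Hv). }
  assert (HuY : forall v, V v ->
            u_Y (e v) (b' v) (s v) (z v) = partial axis2 u v).
  { intros v Hv; rewrite (is_partial_unique _ _ _ _ (Du axis2 v Hv)).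
    symmetry; apply (H1 v Hv). }
  assert (HuZ : forall v, V v -> exp_u_Z (e v) (b' v) (s v) (z v)
            = partial axis3 (fun w => exp (u w)) v).
  { intros v Hv; symmetry; apply is_partial_unique.
    rewrite <- (proj2 (proj2 (H1 v Hv))).
    (* exp u is the closed form [exp_U_slope] at v. *)
    unfold e at 1; rewrite <- exp_U_slopeE by now apply Hz.
    rewrite (Hu v Hv : U_slope _ _ (z v) = _).
    apply (is_partial_comp axis3 exp u); [apply is_derive_exp | now apply Du]. }
  intros v Hv.
  assert (Je := fun i => is_partial_jet (De i v Hv)).
  assert (Jb := fun i => is_partial_jet (Db i v Hv)).
  assert (Js := fun i => is_partial_jet (Ds i v Hv)).
  assert (Jz := fun i => is_partial_jet (Dz i v)).
  rewrite (is_partial_unique axis1 (partial axis1 u) v _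
    (is_partial_ext_on _ _ _ _ _ _ HV HuX Hv
      (is_derive_u_X _ _ _ _ _ _ _ _ _ _ _ _ _ (He v) (Hz v Hv) (HK v Hv)
         (Je axis1) (Jb axis1) (Js axis1) (Jz axis1)))).
  rewrite (is_partial_unique axis2 (partial axis2 u) v _
    (is_partial_ext_on _ _ _ _ _ _ HV HuY Hv
      (is_derive_u_Y _ _ _ _ _ _ _ _ _ _ _ _ _ (He v) (Hz v Hv) (HK v Hv)
         (Je axis2) (Jb axis2) (Js axis2) (Jz axis2)))).
  rewrite (is_partial_unique axis3 (partial axis3 (fun w => exp (u w))) v _
    (is_partial_ext_on _ _ _ _ _ _ HV HuZ Hv
      (is_derive_exp_u_Z _ _ _ _ _ _ _ _ _ _ _ _ _ (He v) (Hz v Hv) (HK v Hv)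
         (Je axis3) (Jb axis3) (Js axis3) (Jz axis3)))).
  exact (toda_identity _ _ _ _ _ (He v) (Hz v Hv) (HK v Hv)).
Qed.

Theorem mainTheorem3 (a b : Rbar) (B beta gamma : R -> R)
  (hB : smooth_on_interval a b B)
  (hbeta : antiderivative_on a b B beta)
  (hgamma : antiderivative_on a b (fun y => exp (- 2 * beta y)) gamma)
  (W V : R3 -> Prop)
  (hW : forall y p Z : R, W (y, p, Z) -> in_interval a b y /\ Z <> 0)
  (hcoord : diffeomorphism W V (XYZ_of beta gamma))
  (u : R3 -> R)
  (hu : forall y p Z : R, W (y, p, Z) ->
     u (X_of beta y p Z, Y_of beta gamma y p Z, Z) = U_of beta y p Z) :
  solves_SU_infty_Toda V u.
Proof.
  destruct (diffeomorphism_hodograph a b beta gamma W V hW hcoord)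
    as [y [p [Hyp HW]]].
  apply (hodograph_toda a b B beta gamma V y _ u hB hbeta hgamma Hyp).
  intros v Hv; destruct (HW v Hv) as [Hw Ev].
  rewrite <- U_of_slope by exact (hodograph_Z Hyp Hv).
  rewrite <- (hu _ _ _ Hw); f_equal; now symmetry.
Qed.
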